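(* The diagram $\vec{D}^{\mathrm{u}}$ can be lifted, with respect to the functor $\mathrm{V}^1$, by a commutative diagram of unital exchange rings (and unital ring homomorphisms). That is, there is a $\{0,1\}^3$-indexed commutative diagram $\vec{R}$ of unital exchange rings and unital ring homomorphisms such that $\mathrm{V}^1\vec{R}$ is naturally isomorphic to $\vec{D}^{\mathrm{u}}$ as a diagram of monoids with order-unit.
   Context: $\mathbb{Z}^+=\{0,1,2,\dots\}$. The diagram $\vec{D}^{\mathrm{u}}$ is the commutative diagram of commutative monoids with order-unit (morphisms being monoid homomorphisms preserving the distinguished order-units), indexed by the cube $\{0,1\}^3$, with bottom vertex $(\boldsymbol{A},1)$, top vertex $(\boldsymbol{B},2)$, where $\boldsymbol{A}=\boldsymbol{B}=\mathbb{Z}^+$, and middle vertices $(\boldsymbol{A}_j,(1,1))$, $(\boldsymbol{B}_j,(1,1))$, where $\boldsymbol{A}_j=\boldsymbol{B}_j=\mathbb{Z}^+\times\mathbb{Z}^+$, $j\in\{0,1,2\}$. Let $\boldsymbol{e}(x)=(x,x)$, $\boldsymbol{s}(x,y)=(y,x)$, $\boldsymbol{h}(x,y)=x+y$. The arrows are: $\boldsymbol{e}\colon\boldsymbol{A}\to\boldsymbol{A}_j$ for each $j$; the identity maps $\boldsymbol{A}_0\to\boldsymbol{B}_2$, $\boldsymbol{A}_0\to\boldsymbol{B}_1$, $\boldsymbol{A}_1\to\boldsymbol{B}_0$, $\boldsymbol{A}_2\to\boldsymbol{B}_1$, $\boldsymbol{A}_2\to\boldsymbol{B}_0$; the map $\boldsymbol{s}\colon\boldsymbol{A}_1\to\boldsymbol{B}_2$;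 and $\boldsymbol{h}\colon\boldsymbol{B}_j\to\boldsymbol{B}$ for each $j$. A ring $R$ is an exchange ring if for every $x\in R$ there are an idempotent $e\in R$ and $r,s\in R$ with $e=rx=x+s-sx$. For a ring $R$, $\mathrm{V}(R)$ is the commutative monoid of equivalence classes $[a]_R$ of idempotents $a$ of $\mathrm{M}_\infty(R)=\bigcup_n\mathrm{M}_n(R)$ (embedding $\mathrm{M}_n(R)$ into $\mathrm{M}_{n+1}(R)$ by adding a zero row and column), where $a\sim b$ if $a=xy$, $b=yx$ for some $x,y\in\mathrm{M}_\infty(R)$, with addition determined by $[a]_R+[b]_R=[a+b]_R$ whenever $ab=ba=0$. A ring homomorphism $f\colon R\to S$ induces $\mathrm{V}(f)\colon[a]_R\mapsto[f(a)]_S$. For unital $R$, $\mathrm{V}^1(R)=(\mathrm{V}(R),[1_R])$. *)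

(* Defs.v *)
From HB Require Import structures.
From mathcomp Require Import all_boot all_order all_algebra.
From mathcomp Require Import boolp.

Set Implicit Arguments.
Unset Strict Implicit.
Unset Printing Implicit Defensive.

Import GRing.Theory.
Local Open Scope ring_scope.
Local Open Scope quotient_scope.

Definition exchange_ring (R : pzRingType) : Prop :=
  forall x : R, exists e r s : R,
    [/\ e * e = e, e = r * x & e = x + s - s * x].

(* An element of M_oo(R) is represented by a square matrix of any size, a matrix
   being identified with its paddings by zero rows and columns. *)

Definition pad (R : pzRingType) (n N : nat) (a : 'M[R]_n) : 'M[R]_N :=
  \matrix_(i < N, j < N)
    if (insub (val i) : option 'I_n, insub (val j) : option 'I_n)
      is (Some i', Some j') then a i' j' else 0.

Record idem_mx (R : pzRingType) := IdemMx {
  idem_size : nat;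
  idem_val :> 'M[R]_idem_size;
  idem_valP : idem_val *m idem_val = idem_val }.
Arguments IdemMx {R idem_size} idem_val idem_valP.

HB.instance Definition _ (R : pzRingType) := gen_eqMixin (idem_mx R).
HB.instance Definition _ (R : pzRingType) := gen_choiceMixin (idem_mx R).

Definition idem_equiv (R : pzRingType) (a b : idem_mx R) : Prop :=
  exists (N : nat) (x y : 'M[R]_N),
    [/\ (idem_size a <= N)%N, (idem_size b <= N)%N,
        pad N a = x *m y & pad N b = y *m x].

Section IdemEquivTheory.
Variable R : pzRingType.
Implicit Types a b c : idem_mx R.

Lemma padE n N (a : 'M[R]_n) :
  pad N a = (pid_mx n : 'M_(N, n)) *m a *m (pid_mx n : 'M_(n, N)).
Proof.
have pidr m (c : 'M[R]_(m, n)) (i : 'I_m) (j : 'I_N) :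
    (c *m (pid_mx n : 'M_(n, N))) i j
      = if insub (val j) is Some j' then c i j' else 0.
  rewrite mxE; case: insubP => [j' _ jj'|ltjn].
    rewrite (bigD1 j') //= big1 => [|k nkj]; rewrite !mxE.
      by rewrite jj' eqxx -jj' ltn_ord mulr1 addr0.
    by rewrite -jj' (inj_eq val_inj) (negPf nkj) mulr0.
  apply: big1 => k _; rewrite mxE; case: eqP => [kj|]; last by rewrite mulr0.
  by move: ltjn; rewrite /= -kj ltn_ord.
have pidl m (c : 'M[R]_(n, m)) (i : 'I_N) (j : 'I_m) :
    ((pid_mx n : 'M_(N, n)) *m c) i j
      = if insub (val i) is Some i' then c i' j else 0.
  rewrite mxE; case: insubP => [i' _ ii'|ltin].
    rewrite (bigD1 i') //= big1 => [|k nki]; rewrite !mxE.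
      by rewrite ii' eqxx -[X in (X < n)%N]ii' ltn_ord mul1r addr0.
    by rewrite -ii' (inj_eq val_inj) eq_sym (negPf nki) mul0r.
  apply: big1 => k _; rewrite mxE; case: eqP => [ik|]; last by rewrite mul0r.
  by move: ltin; rewrite /= ik ltn_ord.
apply/matrixP=> i j; rewrite pidr mxE.
by case: (insub (val i) : option 'I_n) (pidl _ a i) => [i'|] aE;
  case: insub => // j'; rewrite aE.
Qed.

Let pidK n N : (n <= N)%N ->
  (pid_mx n : 'M[R]_(n, N)) *m (pid_mx n : 'M_(N, n)) = 1%:M.
Proof. by move=> le_nN; rewrite mul_pid_mx minnn (minn_idPr le_nN) pid_mx_1. Qed.

(* The paddings can be avoided by using rectangular matrices. *)
Lemma idem_equivP a b : idem_equiv a b <->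
  exists (x : 'M[R]_(idem_size a, idem_size b))
         (y : 'M[R]_(idem_size b, idem_size a)),
    (a : 'M_ _) = x *m y /\ (b : 'M_ _) = y *m x.
Proof.
case: a b => n a aI [m b bI]; split=> /=.
  case=> N [x [y [/= le_nN le_mN]]].
  have bK : pad N b *m (pid_mx m *m (pid_mx m : 'M_(m, N))) = pad N b.
    by rewrite padE -!mulmxA (mulmxA (pid_mx m : 'M_(m, N))) pidK // mul1mx.
  have aK : pad N a *m (pid_mx n *m (pid_mx n : 'M_(n, N))) = pad N a.
    by rewrite padE -!mulmxA (mulmxA (pid_mx n : 'M_(n, N))) pidK // mul1mx.
  have padI k (c : 'M[R]_k) : (k <= N)%N -> c *m c = c ->
      pad N c *m pad N c = pad N c.
    move=> le_kN cI; rewrite padE !mulmxA -(mulmxA (_ *m c)) pidK //.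
    by rewrite mulmx1 -(mulmxA _ c c) cI.
  have padK k (c : 'M[R]_k) : (k <= N)%N ->
      c = (pid_mx k : 'M_(k, N)) *m pad N c *m (pid_mx k : 'M_(N, k)).
    move=> le_kN.
    by rewrite padE !mulmxA pidK // mul1mx -mulmxA pidK // mulmx1.
  move: (padI _ _ le_nN aI) (padI _ _ le_mN bI) (padK _ a le_nN) (padK _ b le_mN).
  move: (pad N a) (pad N b) aK bK => A B aK bK AI BI -> -> defA defB.
  exists ((pid_mx n : 'M_(n, N)) *m (x *m B) *m (pid_mx m : 'M_(N, m))).
  exists ((pid_mx m : 'M_(m, N)) *m (y *m A) *m (pid_mx n : 'M_(N, n))).
  split; rewrite -!mulmxA; congr (_ *m _); rewrite !mulmxA;
    congr (_ *m _); rewrite -!mulmxA.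
    rewrite [B *m _]mulmxA [B *m _ *m _]mulmxA -[B *m _ *m _]mulmxA bK.
    by rewrite defB !mulmxA -defA -!mulmxA [x *m (y *m A)]mulmxA -defA !AI.
  rewrite [A *m _]mulmxA [A *m _ *m _]mulmxA -[A *m _ *m _]mulmxA aK.
  by rewrite defA !mulmxA -defB -!mulmxA [y *m (x *m B)]mulmxA -defB !BI.
case=> x [y [defa defb]]; exists (maxn n m).
exists ((pid_mx n : 'M_(_, n)) *m x *m (pid_mx m : 'M_(m, _))).
exists ((pid_mx m : 'M_(_, m)) *m y *m (pid_mx n : 'M_(n, _))).
rewrite leq_maxl leq_maxr !padE /=; split=> //.
  rewrite !mulmxA -(mulmxA (_ *m x)) pidK ?leq_maxr // mulmx1.
  by rewrite defa !mulmxA.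
rewrite !mulmxA -(mulmxA (_ *m y)) pidK ?leq_maxl // mulmx1.
by rewrite defb !mulmxA.
Qed.

Lemma idem_equiv_refl a : idem_equiv a a.
Proof. by apply/idem_equivP; exists a, a; rewrite idem_valP. Qed.

Lemma idem_equiv_sym a b : idem_equiv a b -> idem_equiv b a.
Proof.
by move/idem_equivP=> [x [y [ea eb]]]; apply/idem_equivP; exists y, x.
Qed.

Lemma idem_equiv_trans b a c :
  idem_equiv a b -> idem_equiv b c -> idem_equiv a c.
Proof.
move=> /idem_equivP[x [y [ea eb]]] /idem_equivP[z [w [fb fc]]].
apply/idem_equivP; exists (x *m z), (w *m y); split.
  rewrite -mulmxA (mulmxA z) -fb eb !mulmxA -ea -mulmxA -ea.
  by rewrite idem_valP.
rewrite -mulmxA (mulmxA y) -eb fb !mulmxA -fc -mulmxA -fc.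
by rewrite idem_valP.
Qed.

Definition idem_equivb : rel (idem_mx R) := fun a b => `[< idem_equiv a b >].

Lemma idem_equivb_refl : reflexive idem_equivb.
Proof. by move=> a; apply/asboolP/idem_equiv_refl. Qed.
Lemma idem_equivb_sym : symmetric idem_equivb.
Proof.
by move=> a b; apply/asboolP/asboolP; apply: idem_equiv_sym.
Qed.
Lemma idem_equivb_trans : transitive idem_equivb.
Proof.
by move=> b a c /asboolP ab /asboolP bc; apply/asboolP/(idem_equiv_trans ab).
Qed.

Canonical idem_equiv_rel :=
  EquivRel idem_equivb idem_equivb_refl idem_equivb_sym idem_equivb_trans.

End IdemEquivTheory.

Definition V (R : pzRingType) := {eq_quot (@idem_equivb R)}.

HB.instance Definition _ (R : pzRingType) := Choice.on (V R).
HB.instance Definition _ (R : pzRingType) := EqQuotient.on (V R).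

Definition Vclass (R : pzRingType) (a : idem_mx R) : V R := \pi_(V R) a.

Definition Vrepr (R : pzRingType) (u : V R) : idem_mx R := repr u.

Section DirectSum.
Variable R : pzRingType.
Implicit Types a b c : idem_mx R.

Lemma idem_dsum_proof a b :
  block_mx (a : 'M_ _) 0 0 (b : 'M_ _) *m block_mx (a : 'M_ _) 0 0 (b : 'M_ _)
  = block_mx (a : 'M_ _) 0 0 (b : 'M_ _).
Proof.
by rewrite mulmx_block !mul0mx !mulmx0 !addr0 !add0r !idem_valP.
Qed.

Definition idem_dsum a b : idem_mx R := IdemMx _ (idem_dsum_proof a b).

Lemma idem0_proof n : (0 : 'M[R]_n) *m (0 : 'M_n) = 0.
Proof. exact: mul0mx. Qed.

Definition idem0 n : idem_mx R := IdemMx _ (idem0_proof n).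

Lemma idem1_proof n : (1%:M : 'M[R]_n) *m (1%:M : 'M_n) = 1%:M.
Proof. exact: mul1mx. Qed.

Definition idem1 n : idem_mx R := IdemMx _ (idem1_proof n).

(* diag(a, 0) and diag(0, b) are orthogonal representatives of [a] and [b], so
   the rule [a] + [b] = [a + b] for ab = ba = 0 leaves this as the only choice;
   the rule itself is VclassD_orth. *)
Definition Vadd (u v : V R) : V R := Vclass (idem_dsum (Vrepr u) (Vrepr v)).

Definition Vzero : V R := Vclass (idem0 0).

Lemma VclassP a b : Vclass a = Vclass b <-> idem_equiv a b.
Proof.
split=> [/eqmodP/asboolP //|ab]; exact/eqmodP/asboolP.
Qed.

Lemma VreprK (u : V R) : Vclass (Vrepr u) = u.
Proof. exact: reprK. Qed.

Lemma V_ind (P : V R -> Prop) : (forall a, P (Vclass a)) -> forall u, P u.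
Proof. by move=> Pcl u; rewrite -(VreprK u). Qed.

Lemma Vclass_dsum a b : Vadd (Vclass a) (Vclass b) = Vclass (idem_dsum a b).
Proof.
have /VclassP/idem_equivP[x [y [ea eb]]] := VreprK (Vclass a).
have /VclassP/idem_equivP[z [w [ec ed]]] := VreprK (Vclass b).
apply/VclassP/idem_equivP; exists (block_mx x 0 0 z), (block_mx y 0 0 w).
rewrite !mulmx_block !mul0mx !mulmx0 !addr0 !add0r /=.
by rewrite -ea -eb -ec -ed.
Qed.

Lemma VaddC : commutative Vadd.
Proof.
elim/V_ind=> a; elim/V_ind=> b; rewrite !Vclass_dsum.
apply/VclassP/idem_equivP.
exists (block_mx 0 (a : 'M_ _) (b : 'M_ _) 0).
exists (block_mx 0 (b : 'M_ _) (a : 'M_ _) 0).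
by rewrite !mulmx_block !mul0mx !mulmx0 !addr0 !add0r !idem_valP.
Qed.

Lemma Vadd0 : left_id Vzero Vadd.
Proof.
elim/V_ind=> a; rewrite Vclass_dsum; apply/VclassP/idem_equivP.
exists (col_mx 0 (a : 'M_ _)), (row_mx 0 (a : 'M_ _)).
rewrite mul_col_row mul_row_col !mul0mx !mulmx0 add0r.
by rewrite !idem_valP.
Qed.

Lemma VaddA : associative Vadd.
Proof.
elim/V_ind=> a; elim/V_ind=> b; elim/V_ind=> c; rewrite !Vclass_dsum.
apply/VclassP/idem_equiv_sym/idem_equivP => /=.
exists (col_mx (col_mx (row_mx (a : 'M_ _) 0) (row_mx 0 (row_mx (b : 'M_ _) 0)))
          (row_mx 0 (row_mx 0 (c : 'M_ _)))).
exists (row_mx (row_mx (col_mx (a : 'M_ _) 0) (col_mx 0 (col_mx (b : 'M_ _) 0)))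
          (col_mx 0 (col_mx 0 (c : 'M_ _)))).
split.
  have colE m1 m2 n1 n2 (X : 'M[R]_(m1, n1)) (Y : 'M[R]_(m2, n1)) :
      col_mx (row_mx X 0) (row_mx Y (0 : 'M_(m2, n2))) = row_mx (col_mx X Y) 0.
    by rewrite -block_mxEv block_mxEh col_mx0.
  rewrite !(mul_col_mx, mul_mx_row, mul_row_col, mulmx0, mul0mx, addr0, add0r).
  by rewrite !idem_valP row_mx0 colE.
rewrite !mul_row_col !mul_col_row.
rewrite !(mul_col_mx, mul_mx_row, mulmx0, mul0mx, idem_valP, row_mx0, col_mx0).
by rewrite /block_mx ?(row_mx0, col_mx0) !(add_col_mx, add_row_mx, addr0, add0r).
Qed.

End DirectSum.

HB.instance Definition _ (R : pzRingType) :=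
  GRing.isNmodule.Build (V R) (@VaddA R) (@VaddC R) (@Vadd0 R).

Section VTheory.
Variable R : pzRingType.

Lemma VclassD (a b : idem_mx R) :
  Vclass a + Vclass b = Vclass (idem_dsum a b).
Proof. exact: Vclass_dsum. Qed.

Lemma VclassD_orth n (a b c : 'M[R]_n)
    (aI : a *m a = a) (bI : b *m b = b) (cI : c *m c = c) :
    a *m b = 0 -> b *m a = 0 -> c = a + b ->
  Vclass (IdemMx a aI) + Vclass (IdemMx b bI) = Vclass (IdemMx c cI).
Proof.
move=> ab ba defc; rewrite VclassD; apply/VclassP/idem_equivP => /=.
exists (col_mx a b), (row_mx a b); rewrite mul_col_row mul_row_col.
by rewrite aI bI ab ba.
Qed.

Lemma Vclass_pad n N (a : 'M[R]_n) (aI : a *m a = a)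
    (pI : pad N a *m pad N a = pad N a) : (n <= N)%N ->
  Vclass (IdemMx (pad N a) pI) = Vclass (IdemMx a aI).
Proof.
move=> le_nN; apply/VclassP.
exists N, (pad N a), (pad N a); split=> //=; rewrite pI //.
by rewrite padE pid_mx_1 mul1mx mulmx1.
Qed.

Lemma Vclass0 n : Vclass (idem0 R n) = 0.
Proof.
by apply/VclassP/idem_equivP; exists 0, 0; rewrite /= !mulmx0.
Qed.

Lemma Vclass1 n : Vclass (idem1 R n) = Vclass (idem1 R 1) *+ n.
Proof.
elim: n => [|n IHn].
  by rewrite -[RHS](Vclass0 0); apply/VclassP/idem_equivP; exists 0, 0;
     rewrite /= !mulmx0; split; apply/matrixP=> [[]].
rewrite mulrS -IHn VclassD; apply/VclassP/idem_equivP.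
exists 1%:M, 1%:M; rewrite /= mul1mx; split=> //.
exact/esym/(scalar_mx_block 1 n).
Qed.

End VTheory.

Section VMap.
Variables (R S : pzRingType) (f : {rmorphism R -> S}).

Lemma map_idem_proof (a : idem_mx R) :
  map_mx f a *m map_mx f a = map_mx f a.
Proof. by rewrite -map_mxM idem_valP. Qed.

Definition map_idem (a : idem_mx R) : idem_mx S := IdemMx _ (map_idem_proof a).

Definition Vmap (u : V R) : V S := Vclass (map_idem (Vrepr u)).

Lemma Vmap_class a : Vmap (Vclass a) = Vclass (map_idem a).
Proof.
have /VclassP/idem_equivP[x [y [ea eb]]] := VreprK (Vclass a).
apply/VclassP/idem_equivP; exists (map_mx f x), (map_mx f y).
by rewrite -!map_mxM -ea -eb.
Qed.

Lemma Vmap_is_nmod_morphism : nmod_morphism Vmap.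
Proof.
split.
  rewrite -(Vclass0 R 0) Vmap_class -(Vclass0 S 0); apply/VclassP/idem_equivP.
  by exists 0, 0; rewrite /= mulmx0 map_mx0.
elim/V_ind=> a; elim/V_ind=> b; rewrite (VclassD a b) !Vmap_class (VclassD (map_idem a)).
apply/VclassP/idem_equivP.
exists (map_idem (idem_dsum a b) : 'M_ _).
exists (map_idem (idem_dsum a b) : 'M_ _).
have P := map_idem_proof (idem_dsum a b); split; first exact/esym/P.
by apply/esym; rewrite [LHS]P /= map_block_mx !map_mx0.
Qed.

HB.instance Definition _ :=
  GRing.isNmodMorphism.Build (V R) (V S) Vmap Vmap_is_nmod_morphism.

End VMap.

Definition order_unit (M : nmodType) (u : M) : Prop :=
  forall x : M, exists (n : nat) (y : M), x + y = u *+ n.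

Record ou_monoid := OuMonoid {
  ou_sort :> nmodType;
  ou_unit : ou_sort;
  ou_unitP : order_unit ou_unit }.

Record ou_hom (M N : ou_monoid) := OuHom {
  ou_map :> {additive M -> N};
  ou_map_unit : ou_map (ou_unit M) = ou_unit N }.

Lemma V1_order_unit (R : pzRingType) : order_unit (Vclass (idem1 R 1)).
Proof.
elim/V_ind=> -[n a aI].
have bI : (1%:M - a) *m (1%:M - a) = 1%:M - a.
  by rewrite mulmxBl mul1mx mulmxBr mulmx1 aI subrr subr0.
exists n, (Vclass (IdemMx _ bI)); rewrite -Vclass1; apply: VclassD_orth.
- by rewrite mulmxBr mulmx1 aI subrr.
- by rewrite mulmxBl mul1mx aI subrr.
- by rewrite addrC subrK.
Qed.

Definition V1 (R : pzRingType) : ou_monoid := OuMonoid (@V1_order_unit R).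

Lemma V1_map_unit (R S : pzRingType) (f : {rmorphism R -> S}) :
  Vmap f (ou_unit (V1 R)) = ou_unit (V1 S).
Proof.
rewrite Vmap_class; apply/VclassP/idem_equivP; exists 1%:M, 1%:M.
by rewrite /= map_mx1 mulmx1.
Qed.

Definition V1_map (R S : pzRingType) (f : {rmorphism R -> S}) :
    ou_hom (V1 R) (V1 S) :=
  @OuHom (V1 R) (V1 S) (Vmap f) (V1_map_unit f).

Record ring_diagram (d : Order.disp_t) (I : porderType d) := RingDiagram {
  rd_ob :> I -> pzRingType;
  rd_map : forall p q : I, (p <= q)%O -> {rmorphism rd_ob p -> rd_ob q};
  rd_map_id : forall (p : I) (pp : (p <= p)%O) (x : rd_ob p),
    rd_map pp x = x;
  rd_map_comp : forall (p q r : I) (pq : (p <= q)%O) (qr : (q <= r)%O)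
      (pr : (p <= r)%O) (x : rd_ob p),
    rd_map pr x = rd_map qr (rd_map pq x) }.

Record ou_diagram (d : Order.disp_t) (I : porderType d) := OuDiagram {
  od_ob :> I -> ou_monoid;
  od_map : forall p q : I, (p <= q)%O -> ou_hom (od_ob p) (od_ob q);
  od_map_id : forall (p : I) (pp : (p <= p)%O) (x : od_ob p),
    od_map pp x = x;
  od_map_comp : forall (p q r : I) (pq : (p <= q)%O) (qr : (q <= r)%O)
      (pr : (p <= r)%O) (x : od_ob p),
    od_map pr x = od_map qr (od_map pq x) }.

Definition ou_diagram_iso (d : Order.disp_t) (I : porderType d)
    (X Y : ou_diagram I) : Prop :=
  exists phi : forall p : I, ou_hom (X p) (Y p),
    (forall p : I, bijective (phi p)) /\
    (forall (p q : I) (pq : (p <= q)%O) (x : X p),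
       phi q (od_map X pq x) = od_map Y pq (phi p x)).

Section V1Diagram.
Variables (d : Order.disp_t) (I : porderType d) (X : ring_diagram I).

Lemma V1_diagram_id (p : I) (pp : (p <= p)%O) (u : V1 (X p)) :
  V1_map (rd_map X pp) u = u.
Proof.
elim/V_ind: u => a; rewrite /= Vmap_class; apply/VclassP/idem_equivP.
have e : map_mx (rd_map X pp) a = a.
  by apply/matrixP=> i j; rewrite mxE rd_map_id.
by exists a, a; rewrite /= e idem_valP.
Qed.

Lemma V1_diagram_comp (p q r : I) (pq : (p <= q)%O) (qr : (q <= r)%O)
    (pr : (p <= r)%O) (u : V1 (X p)) :
  V1_map (rd_map X pr) u = V1_map (rd_map X qr) (V1_map (rd_map X pq) u).
Proof.
elim/V_ind: u => a; rewrite /= !Vmap_class; apply/VclassP/idem_equivP.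
have e : map_mx (rd_map X qr) (map_mx (rd_map X pq) a) = map_mx (rd_map X pr) a.
  by apply/matrixP=> i j; rewrite !mxE -rd_map_comp.
exists (map_mx (rd_map X pr) a), (map_mx (rd_map X pr) a).
by rewrite /= e -map_mxM idem_valP.
Qed.

Definition V1_diagram : ou_diagram I :=
  OuDiagram V1_diagram_id V1_diagram_comp.

End V1Diagram.

Definition cube : porderType _ := (bool *p bool *p bool)%type.

Variant level := Bottom | Lower of 'I_3 | Upper of 'I_3 | Top.

Definition j0 : 'I_3 := @Ordinal 3 0 isT.
Definition j1 : 'I_3 := @Ordinal 3 1 isT.
Definition j2 : 'I_3 := @Ordinal 3 2 isT.

(* The vertex of A_j (Lower j) is the atom {j} and the vertex of B_j (Upper j)
   is the complementary coatom, so that there is an arrow from A_i to B_j exactly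
   when i <> j. *)
Definition level_of (p : cube) : level :=
  match p with
  | (false, false, false) => Bottom
  | (true, false, false) => Lower j0
  | (false, true, false) => Lower j1
  | (false, false, true) => Lower j2
  | (false, true, true) => Upper j0
  | (true, false, true) => Upper j1
  | (true, true, false) => Upper j2
  | (true, true, true) => Top
  end.

Definition e_map (x : nat) : nat * nat := (x, x).
Definition s_map (x : nat * nat) : nat * nat := (x.2, x.1).
Definition h_map (x : nat * nat) : nat := x.1 + x.2.

Lemma nat_mulrn (u n : nat) : u *+ n = (u * n)%N.
Proof. by elim: n => [|n IHn]; rewrite ?muln0 // mulrS IHn mulnS. Qed.

Lemma nat_order_unit (u : nat) : (0 < u)%N -> order_unit u.
Proof.
move=> u0 x; exists x, (u * x - x)%N.
by rewrite nat_mulrn; apply: subnKC; rewrite leq_pmull.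
Qed.

Lemma nat2_order_unit : order_unit ((1, 1)%N : nat * nat).
Proof.
move=> [x y]; exists (x + y)%N, (y, x).
have -> n : ((1, 1)%N : nat * nat) *+ n = (n, n).
  by elim: n => // n IHn; rewrite mulrS IHn.
by congr (_, _); apply: addnC.
Qed.

Definition nat_ou1 : ou_monoid := OuMonoid (@nat_order_unit 1 isT).
Definition nat_ou2 : ou_monoid := OuMonoid (@nat_order_unit 2 isT).
Definition nat2_ou : ou_monoid := OuMonoid nat2_order_unit.

Definition Du_level (k : level) : ou_monoid :=
  match k with
  | Bottom => nat_ou1
  | Lower _ | Upper _ => nat2_ou
  | Top => nat_ou2
  end.

(* The last case is never used between comparable vertices of the cube. *)
Definition Du_fun (k l : level) : Du_level k -> Du_level l :=
  match k, l with
  | Bottom, Bottom => id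
  | Bottom, Lower _ => e_map
  | Bottom, Upper _ => e_map
  | Bottom, Top => h_map \o e_map
  | Lower _, Lower _ => id
  | Lower i, Upper j => if (i == j1) && (j == j2) then s_map else id
  | Lower _, Top => h_map
  | Upper _, Upper _ => id
  | Upper _, Top => h_map
  | Top, Top => id
  | _, _ => fun=> 0
  end.

Lemma Du_fun_is_nmod_morphism (k l : level) : nmod_morphism (@Du_fun k l).
Proof.
have hD (x y : nat * nat) : h_map (x + y) = h_map x + h_map y.
  exact: addrACA.
case: k l => [|i|i|] [|j|j|] //=; try by split=> // x y; rewrite ?addr0.
- by split=> // x y; rewrite /= -hD.
- by case: ifP.
Qed.

HB.instance Definition _ (k l : level) :=
  GRing.isNmodMorphism.Build (Du_level k) (Du_level l) (@Du_fun k l)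
    (@Du_fun_is_nmod_morphism k l).

Definition Du_ob (p : cube) : ou_monoid := Du_level (level_of p).

Lemma Du_fun_unit (p q : cube) : (p <= q)%O ->
  @Du_fun (level_of p) (level_of q) (ou_unit (Du_ob p)) = ou_unit (Du_ob q).
Proof. by case: p q => [[[] []] []] [[[] []] []]. Qed.

Definition Du_map (p q : cube) (pq : (p <= q)%O) : ou_hom (Du_ob p) (Du_ob q) :=
  @OuHom (Du_ob p) (Du_ob q) (@Du_fun (level_of p) (level_of q))
    (Du_fun_unit pq).

Lemma Du_map_id (p : cube) (pp : (p <= p)%O) (x : Du_ob p) : Du_map pp x = x.
Proof. by case: p pp x => [[[] []] []]. Qed.

Lemma Du_map_comp (p q r : cube) (pq : (p <= q)%O) (qr : (q <= r)%O)
    (pr : (p <= r)%O) (x : Du_ob p) :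
  Du_map pr x = Du_map qr (Du_map pq x).
Proof.
have hs (y : nat * nat) : h_map (s_map y) = h_map y by exact: addrC.
by case: p q r pq qr pr x => [[[] []] []] [[[] []] []] [[[] []] []] //= *;
  rewrite ?hs.
Qed.

Definition Du : ou_diagram cube := OuDiagram Du_map_id Du_map_comp.

(* Main.v *)
Require Import Defs.
From HB Require Import structures.
From mathcomp Require Import all_boot all_order all_algebra.
From mathcomp Require Import ring lra.

(* Let Z, Y, X be three distinct lines of the plane k^2, with k of
   characteristic 0, and attach to a vertex p of the cube the ring of all
   2 x 2 matrices fixing the j-th line for each j with p_j = 0; the arrows are
   the inclusions. So A is the ring of scalar matrices, A_0, A_1, A_2 fix
   {X, Y}, {Z, X}, {Z, Y}, the B_j fix a single line, and B is the full matrix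
   ring. The action on an invariant line and on the quotient by it gives the
   characters identifying V with Z^+ x Z^+. On A_1 the pair (Z, X) is used:
   modulo the radical of B_2, the stabilizer of X, the projection with image Z
   and kernel X is the complement of the projection with image X and kernel Y,
   whence the map s; all the other arrows into the B_j are identities.
   Exchange follows from Cayley-Hamilton. *)

Set Implicit Arguments.
Unset Strict Implicit.
Unset Printing Implicit Defensive.

Import Order.TTheory GRing.Theory Num.Theory.
Local Open Scope ring_scope.

(** * Flattening matrices over a ring of matrices *)

Section Flatten.
Variables (k : fieldType) (d : nat) (R : pzRingType).
Variable f : {rmorphism R -> 'M[k]_d.+1}.

Definition flatten_mx n (a : 'M[R]_n) : 'M[k]_(\sum_(i < n) d.+1) :=
  \mxblock_(i < n, j < n) f (a i j).

Lemma flatten_mxM n (a b : 'M[R]_n) :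
  flatten_mx (a *m b) = flatten_mx a *m flatten_mx b.
Proof.
rewrite mul_mxblock; apply: eq_mxblock => i j.
by rewrite mxE rmorph_sum; apply: eq_bigr => l _; rewrite rmorphM.
Qed.

Lemma flatten_mxB n (a b : 'M[R]_n) :
  flatten_mx (a - b) = flatten_mx a - flatten_mx b.
Proof. by rewrite -mxblockB; apply: eq_mxblock => i j; rewrite !mxE rmorphB. Qed.

Lemma flatten_mx_inj n : injective f -> injective (@flatten_mx n).
Proof.
move=> f_inj a b /(congr1 (fun M => submxblock M _ _)) ab; apply/matrixP => i j.
by apply: f_inj; have := ab i j; rewrite !mxblockK.
Qed.

(** This drop in rank drives the induction in [V_generated]. Were the ranks equal, the flattening of
    [a] would be a left multiple of that of [a - g]; since [(a - g) *m g = 0], this would force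
    [g = a *m g = 0]. *)
Lemma rank_flatten_sub n (a g : 'M[R]_n) : injective f ->
  a *m a = a -> a *m g = g -> g *m a = g -> g *m g = g -> g != 0 ->
  (\rank (flatten_mx (a - g)) < \rank (flatten_mx a))%N.
Proof.
move=> f_inj aa ag ga gg g0.
have := mxrank_leqif_sup (_ : flatten_mx (a - g) <= flatten_mx a)%MS.
have bE : a - g = (a - g) *m a by rewrite mulmxBl aa ga.
have bg : (a - g) *m g = 0 by rewrite mulmxBl ag gg subrr.
rewrite {1}bE flatten_mxM => /(_ (submxMl _ _)) rk; rewrite ltn_neqAle !rk andbT.
apply: contra g0 => /submxP[c ac]; apply/eqP/(flatten_mx_inj f_inj).
rewrite -ag flatten_mxM ac -mulmxA -flatten_mxM bg.
by rewrite -[X in flatten_mx X](subrr a) flatten_mxB subrr mulmx0.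
Qed.

End Flatten.

(** * Generators of V *)

Lemma scalar_idem_proof (R : pzRingType) (e : R) :
  e * e = e -> e%:M *m e%:M = e%:M :> 'M_1.
Proof. by rewrite -scalar_mxM => ->. Qed.

Definition scalar_idem (R : pzRingType) (e : R) (ee : e * e = e) : idem_mx R :=
  IdemMx _ (scalar_idem_proof ee).

Section Generation.
Variables (k : fieldType) (d : nat) (R : pzRingType).
Variable f : {rmorphism R -> 'M[k]_d.+1}.
Hypothesis f_inj : injective f.
Variables (I : Type) (e : I -> R) (J : pred R).
Hypothesis e_idem : forall i, e i * e i = e i.
Hypothesis e_neq0 : forall i, e i != 0.
Hypothesis J_sqr0 : forall x y, J x -> J y -> x * y = 0.
Hypothesis J_ext : forall w, J w \/ exists i r s, r * w * s = e i.

(* An idempotent with all entries in J is zero; otherwise some entry w with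
   r w s = e_i splits off an orthogonal summand equivalent to e_i. *)
Lemma V_generated (P : V R -> Prop) :
  P 0 -> (forall i u, P u -> P (Vclass (scalar_idem (e_idem i)) + u)) ->
  forall u, P u.
Proof.
move=> P0 PS; elim/V_ind=> -[n a aI].
have [m le_m] := ubnP (\rank (flatten_mx f a)).
elim: m => // m IHm in a aI le_m *.
have [/forallP aJ|/forallPn[i /forallPn[j nJ]]] :=
  boolP [forall i, forall j, J (a i j)].
  suff a0 : a = 0.
    rewrite (_ : Vclass _ = 0) // -(Vclass0 R n); apply/VclassP/idem_equivP.
    by exists a, a => /=; rewrite aI a0.
  rewrite -aI; apply/matrixP => i j; rewrite !mxE big1 // => l _.
  by apply: J_sqr0; [have /forallP := aJ i; apply | have /forallP := aJ l; apply].
have [/(negP nJ)//|[l [r [s rws]]]] := J_ext (a i j).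
(* As [a] is idempotent, its row [i] times its column [j] is the entry [a i j]. The factors [e l]
   make [y] and [x] absorb [e l], so that [x *m y] is an idempotent equivalent to [e l]. *)
pose y := (e l * r)%:M *m row i a : 'M_(1, n).
pose x := col j a *m (s * e l)%:M : 'M_(n, 1).
have yx : y *m x = (e l)%:M.
  have rc : row i a *m col j a = (a i j)%:M.
    apply/matrixP => u v; rewrite !ord1 !mxE -[in RHS]aI mxE.
    by apply: eq_bigr => t _; rewrite !mxE.
  rewrite /y /x mulmxA -(mulmxA _ (row i a)) rc -!scalar_mxM.
  by rewrite !mulrA -(mulrA (e l)) -(mulrA (e l)) rws !e_idem.
have ya : y *m a = y by rewrite -mulmxA -row_mul aI.
have ax : a *m x = x.
  by rewrite mulmxA (_ : a *m col j a = col j a) // colE mulmxA aI.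
have ex : x *m (e l)%:M = x by rewrite -mulmxA -scalar_mxM -mulrA e_idem.
have ey : (e l)%:M *m y = y by rewrite mulmxA -scalar_mxM mulrA e_idem.
pose g := x *m y.
have gg : g *m g = g by rewrite /g mulmxA -(mulmxA x) yx ex.
have ag : a *m g = g by rewrite /g mulmxA ax.
have ga : g *m a = g by rewrite /g -mulmxA ya.
have g0 : g != 0.
  apply/eqP => g0; have /eqP[] := e_neq0 l.
  have : y *m g *m x = (e l)%:M by rewrite /g mulmxA yx ey.
  rewrite g0 mulmx0 mul0mx => /matrixP/(_ 0 0).
  by rewrite !mxE mulr1n.
have bI : (a - g) *m (a - g) = a - g.
  by rewrite mulmxBl !mulmxBr aI ag ga gg subrr subr0.
rewrite -(VclassD_orth gg bI aI); first last.
- by rewrite addrC subrK.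
- by rewrite mulmxBl ag gg subrr.
- by rewrite mulmxBr ga gg subrr.
rewrite (_ : Vclass (IdemMx g gg) = Vclass (scalar_idem (e_idem l))).
  apply/PS/IHm; rewrite ltnS in le_m; apply: leq_trans le_m.
  exact: rank_flatten_sub.
by apply/VclassP/idem_equivP; exists x, y; rewrite /= yx.
Qed.

End Generation.

(** * Additive invariants of V from trace maps *)

Section VTrace.
Variables (R : pzRingType) (A : zmodType) (T : {additive R -> A}).
Hypothesis TC : forall x y, T (x * y) = T (y * x).

(** [R] is noncommutative: the two traces are sums of the same products in opposite orders, which
    only [T] identifies. *)
Lemma mxtraceTC m n (x : 'M[R]_(m, n)) (y : 'M_(n, m)) :
  T (\tr (x *m y)) = T (\tr (y *m x)).
Proof.
rewrite !raddf_sum; under eq_bigr do rewrite mxE raddf_sum.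
under [RHS]eq_bigr do rewrite mxE raddf_sum.
by rewrite exchange_big; do 2!apply: eq_bigr => ? _.
Qed.

Definition Vtrace (u : V R) : A := T (\tr (Vrepr u : 'M_ _)).

Lemma Vtrace_class (a : idem_mx R) : Vtrace (Vclass a) = T (\tr (a : 'M_ _)).
Proof.
have /VclassP/idem_equivP[x [y [ea eb]]] := VreprK (Vclass a).
by rewrite /Vtrace ea eb; exact: mxtraceTC.
Qed.

Lemma Vtrace0 : Vtrace 0 = 0.
Proof. by rewrite -(Vclass0 R 0) Vtrace_class mxtrace0 raddf0. Qed.

Lemma VtraceD u v : Vtrace (u + v) = Vtrace u + Vtrace v.
Proof.
elim/V_ind: u => a; elim/V_ind: v => b.
by rewrite (VclassD a b) !Vtrace_class mxtrace_block raddfD.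
Qed.

End VTrace.

(** * Stabilizers of lines in the plane *)

Lemma mulmx22E (R : pzRingType) (x y : 'M[R]_2) i j :
  (x * y) i j = x i 0 * y 0 j + x i 1 * y 1 j.
Proof.
rewrite mxE !big_ord_recl big_ord0 addr0.
by congr (_ + x _ _ * y _ _); apply/val_inj.
Qed.

Lemma ord2P (i : 'I_2) : i = 0 \/ i = 1.
Proof. by case: i => [[|[]]] // ?; [left|right]; apply/val_inj. Qed.

Lemma matrix22P (R : Type) (x y : 'M[R]_2) :
  x 0 0 = y 0 0 -> x 0 1 = y 0 1 -> x 1 0 = y 1 0 -> x 1 1 = y 1 1 -> x = y.
Proof.
move=> e00 e01 e10 e11; apply/matrixP=> i j.
by case: (ord2P i) (ord2P j) => -> [] ->.
Qed.

Definition mx22 (R : pzRingType) (a b c d : R) : 'M[R]_2 :=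
  \matrix_(i, j) nth 0 (nth [::] [:: [:: a; b]; [:: c; d]] i) j.

(* With matrices acting on row vectors, x fixes the line of (1, 1), (0, 1),
   (1, 0), respectively, unless the corresponding coordinate of p is true. *)
Definition stab (p : cube) : {pred 'M[rat]_2} := fun x =>
  let: (p0, p1, p2) := p in
  [&& p0 || (x 0 0 == x 0 1 + x 1 1 - x 1 0), p1 || (x 1 0 == 0)
    & p2 || (x 0 1 == 0)].

Lemma stabP (p : cube) (x : 'M[rat]_2) : reflect
  [/\ ~~ p.1.1 -> x 0 0 = x 0 1 + x 1 1 - x 1 0, ~~ p.1.2 -> x 1 0 = 0
    & ~~ p.2 -> x 0 1 = 0] (x \in stab p).
Proof.
case: p => [[p0 p1] p2]; rewrite unfold_in /=.
apply: (iffP and3P) => [] [].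
  move=> h0 h1 h2; split=> /negPf pF; [move: h0|move: h1|move: h2];
    by rewrite pF => /eqP.
by move=> h0 h1 h2; split; [case: p0 h0|case: p1 h1|case: p2 h2] => //= h;
  apply/eqP/h.
Qed.

(** At a concrete vertex each premise of [stabP] computes to a boolean: the equations of the fixed
    lines are used, the others dropped. *)
Ltac stab_rewrite :=
  move=> /stabP[] /=; do 3![move=> /(_ isT) -> | move=> _].

Ltac stab_hyps := move=> /stabP[] /=; do 3![move=> /(_ isT) ? | move=> _].

Lemma stab_subring p : subring_closed (stab p).
Proof.
split.
- by apply/stabP; rewrite !mxE.
- move=> x y /stabP[x0 x1 x2] /stabP[y0 y1 y2]; apply/stabP.
  rewrite !mxE; split=> [/[dup]/x0 + /y0|/[dup]/x1 + /y1|/[dup]/x2 + /y2]; lra.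
- move=> x y /stabP[x0 x1 x2] /stabP[y0 y1 y2]; apply/stabP.
  rewrite !mulmx22E; split=> [/[dup]/x0-> /y0->|/[dup]/x1-> /y1->
    |/[dup]/x2-> /y2->]; ring.
Qed.

Lemma stabZ p (c : rat) x : x \in stab p -> c *: x \in stab p.
Proof.
move=> /stabP[x0 x1 x2]; apply/stabP; rewrite !mxE.
by split=> [/x0|/x1|/x2] ->; ring.
Qed.

(* The multiplicities of the two generators of V, read off the trace; the
   second one is 0 at the bottom and the top, where V is Z^+. *)
Definition stab_tr (p : cube) (x : 'M[rat]_2) : rat * rat :=
  match p with
  | (false, false, false) => (x 0 0, 0)
  | (false, true, false) => (x 1 1, x 0 0)
  | (false, true, true) => (x 0 0 + x 1 0, x 1 1 - x 1 0)
  | (true, true, true) => (x 0 0 + x 1 1, 0)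
  | _ => (x 0 0, x 1 1)
  end.

(* At the bottom and the top the two generators coincide. *)
Definition stab_idem (p : cube) (b : bool) : 'M[rat]_2 :=
  match p with
  | (false, false, false) => 1
  | (false, true, false) => if b then mx22 0 0 1 1 else mx22 1 0 (-1) 0
  | (false, false, true) | (false, true, true) =>
    if b then mx22 1 1 0 0 else mx22 0 (-1) 0 1
  | (true, true, true) => mx22 1 0 0 0
  | _ => if b then mx22 1 0 0 0 else mx22 0 0 0 1
  end.

(** The rank meant is that of V: it is 1 at the bottom and the top, and 2 elsewhere. *)
Definition stab_rank1 (p : cube) : bool :=
  (p.1.1 == p.1.2) && (p.1.2 == p.2).

Lemma stab_idem_in p b : stab_idem p b \in stab p.
Proof.
by apply/stabP; case: p b => [[[] []] []] [];
  split=> // _; rewrite !mxE /=; ring.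
Qed.

Lemma stab_idem_idem p b : stab_idem p b * stab_idem p b = stab_idem p b.
Proof.
by case: p b => [[[] []] []] []; apply: matrix22P;
  rewrite !(mulmx22E, mxE) /=; ring.
Qed.

Lemma stab_idem_rank1 p b : stab_rank1 p -> stab_idem p b = stab_idem p true.
Proof. by case: p b => [[[] []] []] []. Qed.

Lemma stab_tr_idem p b :
  stab_tr p (stab_idem p b) = if stab_rank1 p || b then (1, 0) else (0, 1).
Proof. by case: p b => [[[] []] []] []; congr (_, _); rewrite !mxE /=; ring. Qed.

(** On [stab p] each component is zero or multiplicative, except for the full trace at the top. *)
Lemma stab_trM p x y : x \in stab p -> y \in stab p ->
  stab_tr p (x * y) = stab_tr p (y * x).
Proof.
by case: p => [[[] []] []]; rewrite /= !mulmx22E; stab_rewrite; stab_rewrite;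
  congr (_, _); ring.
Qed.

(** On [stab p] this is the Jacobson radical: the common kernel of the characters. At the top the
    trace is no character, and the ring is simple. *)
Definition stab_rad (p : cube) : pred 'M[rat]_2 := fun x =>
  if p is (true, true, true) then x == 0
  else ((stab_tr p x).1 == 0) && ((stab_tr p x).2 == 0).

(** At a [B_j] such elements map the plane into the fixed line and kill that line; at the other
    vertices they are zero. *)
Lemma stab_rad_sqr0 p x y : x \in stab p -> y \in stab p ->
  stab_rad p x -> stab_rad p y -> x * y = 0.
Proof.
(* At [B_0] the fixed line is not a coordinate axis, so the entries are expressed through [x 1 0]
   instead of vanishing. *)
have [->|pU] := eqVneq p (false, true, true).
  move=> /stabP[/(_ isT) x0 _ _] /stabP[/(_ isT) y0 _ _] /andP[/eqP/= x1 /eqP/= x2].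
  move=> /andP[/eqP/= y1 /eqP/= y2].
  have x11 : x 1 1 = x 1 0 by lra.
  have x01 : x 0 1 = - x 1 0 by lra.
  have x00 : x 0 0 = - x 1 0 by lra.
  have y11 : y 1 1 = y 1 0 by lra.
  have y01 : y 0 1 = - y 1 0 by lra.
  have y00 : y 0 0 = - y 1 0 by lra.
  by apply: matrix22P; rewrite mulmx22E !mxE
    !(x00, x01, x11, y00, y01, y11); ring.
case: p pU => [[[] []] []] //= _; rewrite /stab_rad /=;
  try (by move=> _ _ /eqP->; rewrite mul0r).
all: stab_hyps; stab_hyps; move=> /andP[/eqP x1 /eqP x2] /andP[/eqP y1 /eqP y2].
all: have x00 : x 0 0 = 0 by lra.
all: have x11 : x 1 1 = 0 by lra.
all: have y00 : y 0 0 = 0 by lra.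
all: have y11 : y 1 1 = 0 by lra.
all: apply: matrix22P; rewrite mulmx22E !mxE
  !(x00, x11, y00, y11, mul0r, mulr0, addr0, add0r) //.
all: first [have -> : x 1 0 = 0 by lra | have -> : x 0 1 = 0 by lra
  | have -> : y 1 0 = 0 by lra | have -> : y 0 1 = 0 by lra];
  by rewrite (mul0r, mulr0).
Qed.

(** Above the bottom the idempotents have rank 1, so compressing by one leaves a multiple of it,
    given by a character. The condition on the second component excludes the bottom, where this
    component is 0 by convention. *)
Lemma stab_idem_compress p x : p != (true, true, true) -> x \in stab p ->
  stab_idem p true * x * stab_idem p true
    = (stab_tr p x).1 *: stab_idem p true /\
  ((stab_tr p x).2 != 0 ->
    stab_idem p false * x * stab_idem p false
      = (stab_tr p x).2 *: stab_idem p false).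
Proof.
case: p => [[[] []] []] // _; rewrite /= ?eqxx.
all: move=> px; split=> // *; apply: matrix22P;
  move: px; rewrite !(mulmx22E, mxE) /=; stab_rewrite; ring.
Qed.

Lemma stab_rad_ext p x : x \in stab p -> stab_rad p x \/
  exists b r s, [/\ r \in stab p, s \in stab p & r * x * s = stab_idem p b].
Proof.
have [->|pT px] := eqVneq p (true, true, true).
  move=> _; rewrite /stab_rad /=; have [->|/matrix0Pn[i [j xij]]] := eqVneq x 0.
    by left.
  (* Matrix units move the nonzero entry to position [(0, 0)]. *)
  right; exists true, ((x i j)^-1 *: delta_mx 0 i), (delta_mx j 0).
  split; [exact/stabP|exact/stabP|].
  by apply: matrix22P; rewrite !(mulmx22E, mxE) /=;
    case: (ord2P i) (ord2P j) xij => -> [] -> xij;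
    rewrite /= ?(mulr0, mul0r, mulr1, mulr1n, addr0, add0r) ?mulVf.
have [x1 x2] := stab_idem_compress pT px.
have scale b c : c != 0 ->
    stab_idem p b * x * stab_idem p b = c *: stab_idem p b ->
    exists b r s, [/\ r \in stab p, s \in stab p & r * x * s = stab_idem p b].
  move=> c0 ex; exists b, (c^-1 *: stab_idem p b), (stab_idem p b).
  split; rewrite ?stabZ ?stab_idem_in //.
  by rewrite -!scalerAl ex scalerA mulVf // scale1r.
have [t1|t1] := eqVneq (stab_tr p x).1 0; last by right; apply: scale x1.
have [t2|t2] := eqVneq (stab_tr p x).2 0; last by right; apply: scale (x2 t2).
by left; rewrite /stab_rad t1 t2 eqxx;
  case: p pT {px x1 x2 scale t1 t2} => [[[] []] []].
Qed.

(** * The diagram of stabilizer rings *)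

Record stab_ring (p : cube) := StabRing {
  stab_val : 'M[rat]_2; _ : stab_val \in stab p }.
HB.instance Definition _ p := [isSub for @stab_val p].
HB.instance Definition _ p := [Choice of stab_ring p by <:].
HB.instance Definition _ p := 
  GRing.SubChoice_isSubPzRing.Build _ _ (stab_ring p) (stab_subring p).

Lemma stab_le (p q : cube) : (p <= q)%O -> {subset stab p <= stab q}.
Proof.
move=> pq x /stabP[x0 x1 x2]; apply/stabP.
by case: p q pq x0 x1 x2 => [[[] []] []] [[[] []] []].
Qed.

Definition stab_incl (p q : cube) (pq : (p <= q)%O) (x : stab_ring p) :
    stab_ring q := StabRing (stab_le pq (valP x)).

Lemma stab_incl_is_nmod_morphism p q (pq : (p <= q)%O) :
  nmod_morphism (stab_incl pq).
Proof. by split=> [|x y]; apply: val_inj; rewrite ?raddf0 ?raddfD. Qed.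

Lemma stab_incl_is_monoid_morphism p q (pq : (p <= q)%O) :
  monoid_morphism (stab_incl pq).
Proof. by split=> [|x y]; apply: val_inj; rewrite ?rmorph1 ?rmorphM. Qed.

HB.instance Definition _ p q pq := GRing.isNmodMorphism.Build
  (stab_ring p) (stab_ring q) (stab_incl pq) (stab_incl_is_nmod_morphism pq).
HB.instance Definition _ p q pq := GRing.isMonoidMorphism.Build
  (stab_ring p) (stab_ring q) (stab_incl pq) (stab_incl_is_monoid_morphism pq).

Lemma stab_incl_id p (pp : (p <= p)%O) (x : stab_ring p) : stab_incl pp x = x.
Proof. exact: val_inj. Qed.

Lemma stab_incl_comp p q r (pq : (p <= q)%O) (qr : (q <= r)%O) (pr : (p <= r)%O)
  (x : stab_ring p) : stab_incl pr x = stab_incl qr (stab_incl pq x).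
Proof. exact: val_inj. Qed.

Definition stab_diagram : ring_diagram cube :=
  @RingDiagram _ cube (fun p => stab_ring p : pzRingType)
    (fun p q pq => stab_incl pq) stab_incl_id stab_incl_comp.

(** * The exchange property *)

Lemma mx22_Cayley_Hamilton (x : 'M[rat]_2) :
  x * x = (x 0 0 + x 1 1) *: x - (x 0 0 * x 1 1 - x 0 1 * x 1 0) *: 1.
Proof. by apply: matrix22P; rewrite !(mulmx22E, mxE) /=; ring. Qed.

(** If the determinant is nonzero, [x] is invertible and [e = 1]. Otherwise [x * x = tr *: x]:
    either [x] has square zero and [e = 0], or [x] divided by its trace is idempotent. All witnesses
    are polynomials in [x], hence stay in the subring. *)
Lemma stab_exchange p : exchange_ring (stab_ring p).
Proof.
move=> x; pose X := val x.
pose tr := X 0 0 + X 1 1; pose de := X 0 0 * X 1 1 - X 0 1 * X 1 0.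
have XX : X * X = tr *: X - de *: 1 := mx22_Cayley_Hamilton X.
pose el (c : rat) (y : stab_ring p) : stab_ring p := StabRing (stabZ c (valP y)).
have vM (y z : stab_ring p) : val (y * z) = val y * val z by exact: rmorphM.
have vB (y z : stab_ring p) : val (y - z) = val y - val z by exact: rmorphB.
have vD (y z : stab_ring p) : val (y + z) = val y + val z by exact: rmorphD.
have v1 : val (1 : stab_ring p) = 1 by exact: rmorph1.
have vZ c y : val (el c y) = c *: val y by [].
have vE := (vM, vB, vD, v1, vZ).
have [de0|de0] := eqVneq de 0; last first.
  exists 1, (el de^-1 (el tr 1 - x)), 1; split; rewrite ?mul1r //; last first.
    by rewrite [x + 1]addrC addrK.
  apply: val_inj; rewrite !vE -/X -scalerAl mulrBl XX -scalerAl mul1r.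
  by rewrite opprB addrC subrK scalerA mulVf // scale1r.
rewrite de0 scale0r subr0 in XX.
have [tr0|tr0] := eqVneq tr 0.
  rewrite tr0 scale0r in XX; have xx : x * x = 0 by apply: val_inj.
  exists 0, 0, (- x - x * x); rewrite !mul0r xx subr0 mulNr xx oppr0 !subr0.
  by rewrite subrr.
exists (el tr^-1 x), (el tr^-1 1), (el tr^-1 x); split; apply: val_inj.
- by rewrite !vE -scalerAl -scalerAr XX !scalerA -mulrA mulVf // mulr1.
- by rewrite !vE -scalerAl mul1r.
- by rewrite !vE -scalerAl XX scalerA mulVf // scale1r addrAC subrr add0r.
Qed.

(** * V of the stabilizer rings *)

Lemma stab_tr_is_nmod_morphism p : nmod_morphism (stab_tr p).
Proof.
by split=> [|x y]; case: p => [[[] []] []]; congr (_, _); rewrite /= ?mxE; ring.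
Qed.

HB.instance Definition _ p := GRing.isNmodMorphism.Build _ _ (stab_tr p)
  (stab_tr_is_nmod_morphism p).

Definition stab_trace p : {additive stab_ring p -> rat * rat} :=
  (stab_tr p \o \val : {additive stab_ring p -> rat * rat}).

Lemma stab_traceC p (x y : stab_ring p) :
  stab_trace p (x * y) = stab_trace p (y * x).
Proof. exact: stab_trM (valP x) (valP y). Qed.

Definition stab_ring_idem p b : stab_ring p := StabRing (stab_idem_in p b).

Lemma stab_ring_idem_idem p b : stab_ring_idem p b * stab_ring_idem p b = stab_ring_idem p b.
Proof. exact/val_inj/stab_idem_idem. Qed.

Definition stab_class p b : V (stab_ring p) :=
  Vclass (scalar_idem (stab_ring_idem_idem p b)).

Lemma stab_class_rank1 p b : stab_rank1 p -> stab_class p b = stab_class p true.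
Proof.
move=> p1; suff e : stab_ring_idem p b = stab_ring_idem p true.
  apply/VclassP/idem_equivP; exists (stab_ring_idem p true)%:M, (stab_ring_idem p true)%:M.
  by rewrite /= -!scalar_mxM e stab_ring_idem_idem.
exact/val_inj/stab_idem_rank1.
Qed.

Lemma stab_class_generated p (u : V (stab_ring p)) :
  exists m n, u = stab_class p true *+ m + stab_class p false *+ n.
Proof.
pose f : {rmorphism stab_ring p -> 'M[rat]_2} := \val.
pose J (x : stab_ring p) := stab_rad p (val x).
have idem0 b : stab_ring_idem p b != 0.
  apply/eqP => /(congr1 (fun x => stab_tr p (val x))).
  by rewrite stab_tr_idem raddf0; case: ifP.
have J0 (x y : stab_ring p) : J x -> J y -> x * y = 0.
  by move=> xJ yJ; apply/val_inj/(stab_rad_sqr0 (valP x) (valP y)).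
have Jext (w : stab_ring p) :
    J w \/ exists b r s, r * w * s = stab_ring_idem p b.
  have [|[b [r [s [rp sp rws]]]]] := stab_rad_ext (valP w); first by left.
  by right; exists b, (StabRing rp), (StabRing sp); apply: val_inj.
move: u; apply: (V_generated (f := f) (e_idem := stab_ring_idem_idem p) val_inj
  idem0 J0 Jext).
  by exists 0%N, 0%N; rewrite !mulr0n addr0.
move=> [] _ [m [n ->]]; first by exists m.+1, n; rewrite mulrS addrA.
by exists m, n.+1; rewrite mulrS addrCA.
Qed.

Definition Vstab p : V (stab_ring p) -> rat * rat := Vtrace (stab_trace p).
Arguments Vstab : clear implicits.

Lemma Vstab_class p a : Vstab p (Vclass a) = stab_tr p (val (\tr (a : 'M_ _))).
Proof. exact/Vtrace_class/stab_traceC. Qed.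

Lemma VstabD p (u v : V (stab_ring p)) : Vstab p (u + v) = Vstab p u + Vstab p v.
Proof. exact/VtraceD/stab_traceC. Qed.

Lemma VstabMn p (u : V (stab_ring p)) n : Vstab p (u *+ n) = Vstab p u *+ n.
Proof.
elim: n => [|n IHn]; last by rewrite !mulrS VstabD IHn.
exact/Vtrace0/stab_traceC.
Qed.

Lemma Vstab_stab_class p b :
  Vstab p (stab_class p b) = if stab_rank1 p || b then (1, 0) else (0, 1).
Proof. by rewrite Vstab_class /= mxtrace_scalar stab_tr_idem. Qed.

Definition natpair (x : nat * nat) : rat * rat := (x.1%:R, x.2%:R).
Definition truncpair (x : rat * rat) : nat * nat :=
  (Num.truncn x.1, Num.truncn x.2).

Lemma natpairK : cancel natpair truncpair.
Proof. by move=> [m n]; rewrite /truncpair /= !natrK. Qed.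

Lemma natpairD x y : natpair (x + y) = natpair x + natpair y.
Proof. by congr (_, _); rewrite natrD. Qed.

Lemma Vstab_generators p m n :
  Vstab p (stab_class p true *+ m + stab_class p false *+ n)
    = natpair (if stab_rank1 p then (m + n, 0) else (m, n))%N.
Proof.
have nE (x : rat * rat) k : x *+ k = (x.1 *+ k, x.2 *+ k).
  by elim: k => [|k IHk] //; rewrite !mulrS IHk.
rewrite VstabD !VstabMn !Vstab_stab_class orbT orbF !nE.
case: ifP => _; congr (_, _) => /=.
all: by rewrite ?natrD ?(mul0rn, addr0, add0r).
Qed.

Lemma Vstab_nat p (u : V (stab_ring p)) : exists x, Vstab p u = natpair x.
Proof.
by have [m [n ->]] := stab_class_generated u; rewrite Vstab_generators; eexists.
Qed.

(** * The isomorphism with [Du] *)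

Definition Du_out (l : level) : nat * nat -> Du_level l :=
  match l with Bottom | Top => fst | _ => id end.
(** Pairs serve all vertices uniformly, with second coordinate 0 where the monoid is [nat]. *)
Definition Du_in (l : level) : Du_level l -> nat * nat :=
  match l with Bottom | Top => fun m => (m, 0%N) | _ => id end.

Lemma Du_inK l : cancel (@Du_in l) (@Du_out l).
Proof. by case: l. Qed.

Lemma Du_outD l x y : Du_out l (x + y) = Du_out l x + Du_out l y.
Proof. by case: l. Qed.

Lemma Du_out0 l : Du_out l 0 = 0.
Proof. by case: l. Qed.

(** By [Vstab_nat] the truncation loses nothing. *)
Definition stab_iso p (u : V1 (stab_ring p)) : Du_ob p :=
  Du_out (level_of p) (truncpair (Vstab p u)).
Arguments stab_iso : clear implicits.

Lemma stab_iso_is_nmod_morphism p : nmod_morphism (stab_iso p).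
Proof.
split=> [|u v].
  have e : Vstab p 0 = natpair 0 by exact/Vtrace0/stab_traceC.
  by rewrite /stab_iso e natpairK Du_out0.
rewrite /stab_iso VstabD; have [x ->] := Vstab_nat u; have [y ->] := Vstab_nat v.
by rewrite -natpairD !natpairK Du_outD.
Qed.

HB.instance Definition _ p := GRing.isNmodMorphism.Build (V1 (stab_ring p))
  (Du_ob p) (stab_iso p) (stab_iso_is_nmod_morphism p).

(** Characters take the value 1 at the identity, and the trace at the top takes the value 2. *)
Lemma stab_iso_unit p : stab_iso p (ou_unit (V1 (stab_ring p))) = ou_unit (Du_ob p).
Proof.
suff e : Vstab p (ou_unit (V1 (stab_ring p))) = natpair (Du_in (ou_unit (Du_ob p))).
  by rewrite /stab_iso e natpairK Du_inK.
rewrite Vstab_class /= mxtrace1 mulr1n; case: p => [[[] []] []].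
all: by congr (_, _); rewrite /= !mxE.
Qed.

Definition stab_ou_iso p : ou_hom (V1 (stab_ring p)) (Du_ob p) :=
  @OuHom (V1 (stab_ring p)) (Du_ob p) (stab_iso p) (stab_iso_unit p).

Lemma stab_iso_bij p : bijective (stab_iso p).
Proof.
pose psi (y : Du_ob p) := stab_class p true *+ (Du_in y).1
  + stab_class p false *+ (Du_in y).2.
exists psi => [u|y].
  have [m [n ->]] := stab_class_generated u.
  rewrite /psi /stab_iso Vstab_generators natpairK; case: ifP => p1.
    (* Only [m + n] is recovered here, which suffices since the two generators coincide. *)
    rewrite (stab_class_rank1 false p1) -!mulrnDr.
    by case: p p1 {u psi} => [[[] []] []] //= _; rewrite addn0.
  by case: p p1 {u psi} => [[[] []] []].
rewrite /psi /stab_iso Vstab_generators natpairK.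
case: p y {psi} => [[[] []] []] /= y; rewrite ?addn0 //; by case: y.
Qed.

(** The inclusions keep the matrix, so each comparable pair of vertices gives identities linear in
    the entries, modulo the equations of the fixed lines. Natural values are assumed because
    [Du_map] acts on them only. *)
Lemma stab_tr_natural (p q : cube) (pq : (p <= q)%O) x m : x \in stab p ->
  stab_tr p x = natpair m ->
  stab_tr q x = natpair (Du_in (Du_map pq (Du_out (level_of p) m))).
Proof.
case: m => m n.
case: p q pq => [[[] []] []] [[[] []] []] //= _; stab_hyps; case=> xm xn.
all: congr (_, _) => //=; rewrite ?natrD; lra.
Qed.

Lemma stab_iso_natural (p q : cube) (pq : (p <= q)%O) u :
  stab_iso q (V1_map (stab_incl pq) u) = Du_map pq (stab_iso p u).
Proof.
elim/V_ind: u => a; rewrite /stab_iso /= Vmap_class.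
have [m am] := Vstab_nat (Vclass a); rewrite am natpairK.
rewrite Vstab_class /= trace_map_mx; rewrite Vstab_class in am.
by rewrite (stab_tr_natural pq (valP _) am) natpairK Du_inK.
Qed.

Theorem proposition11p3 :
  exists R : ring_diagram cube,
    (forall p : cube, exchange_ring (rd_ob R p)) /\
    ou_diagram_iso (V1_diagram R) Du.
Proof.
exists stab_diagram; split; first exact: stab_exchange.
by exists stab_ou_iso; split; [exact: stab_iso_bij | exact: stab_iso_natural].
Qed.
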